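(* If $S$ is a subset of the Boolean lattice of subsets of $\{1,\ldots,d\}$ such that $\widehat{m}(S,S)\subseteq S$, then there exist sets $\alpha,\beta\subseteq\{1,\ldots,d\}$ such that $$S=\{\gamma:\alpha\subseteq\gamma\subseteq\beta\}.$$
   Context: The Boolean lattice (equivalently the hypercube $\mathbb{H}_d$) has as points the subsets of $\{1,\ldots,d\}$, with distance $d(\gamma,\gamma')=|\gamma\triangle\gamma'|$. For points $a,b$, $$\widehat{m}(a,b)=\{u: d(a,u)=\lfloor d(a,b)/2\rfloor,\ d(a,u)+d(u,b)=d(a,b)\}\cup\{u: d(a,u)=\lceil d(a,b)/2\rceil,\ d(a,u)+d(u,b)=d(a,b)\},$$ and $\widehat{m}(S,T)=\bigcup_{s\in S,t\in T}\widehat{m}(s,t)$. A set $S$ with $\widehat{m}(S,S)\subseteq S$ is called convex. *)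

(* Defs.v *)
From mathcomp Require Import all_boot.

Set Implicit Arguments.
Unset Strict Implicit.
Unset Printing Implicit Defensive.

(* A point of the hypercube is a subset of 'I_d, which stands for {1, .., d}. *)

Definition symdiff (d : nat) (a b : {set 'I_d}) : {set 'I_d} :=
  (a :\: b) :|: (b :\: a).

Definition hdist (d : nat) (a b : {set 'I_d}) : nat := #|symdiff a b|.

(* n./2 is the floor of n / 2 and uphalf n its ceiling. *)
Definition midhat (d : nat) (a b : {set 'I_d}) : {set {set 'I_d}} :=
  [set u | (hdist a u == (hdist a b)./2)
           && (hdist a u + hdist u b == hdist a b)]
  :|: [set u | (hdist a u == uphalf (hdist a b))
               && (hdist a u + hdist u b == hdist a b)].

Definition midhat_set (d : nat) (S T : {set {set 'I_d}}) : {set {set 'I_d}} :=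
  \bigcup_(s in S) \bigcup_(t in T) midhat s t.

(* Main.v *)
Require Import Defs.
From mathcomp Require Import all_boot.
From mathcomp Require Import zify.

(** If [u] lies on a geodesic between two points of [S], strictly before the
midpoint level, then it extends to a geodesic whose midpoint [w] lies beyond [u];
[w] is in [S] and [u] lies on a shorter geodesic from an endpoint to [w].  So [S]
contains all metric intervals between its points, i.e. all [u] with
[a :&: b \subset u \subset a :|: b].  In particular it is closed under
intersection and union, hence has a least and a greatest element. *)

Lemma in_symdiff (d : nat) (a b : {set 'I_d}) x :
  (x \in symdiff a b) = (x \in a) (+) (x \in b).
Proof. by rewrite !inE; case: (x \in a); case: (x \in b). Qed.

Lemma hdistC (d : nat) (a b : {set 'I_d}) : hdist a b = hdist b a.
Proof. by rewrite /hdist /symdiff setUC. Qed.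

Lemma hdist_eq0 (d : nat) (a b : {set 'I_d}) : hdist a b = 0 -> a = b.
Proof.
move/eqP; rewrite cards_eq0 => /eqP ab0; apply/setP => x.
by move/setP/(_ x): ab0; rewrite in_symdiff inE; case: (x \in a); case: (x \in b).
Qed.

Lemma hdist_triangle (d : nat) (a b c : {set 'I_d}) :
  hdist a c <= hdist a b + hdist b c.
Proof.
apply: leq_trans (leq_card_setU _ _); apply/subset_leq_card/subsetP => x.
by rewrite in_setU !in_symdiff; case: (x \in a); case: (x \in b); case: (x \in c).
Qed.

(** No coordinate is flipped both from [a] to [u] and from [u] to [b], so the two symmetric
    differences partition that of [a] and [b]. *)
Lemma hdist_between (d : nat) (a b u : {set 'I_d}) :
  a :&: b \subset u -> u \subset a :|: b -> hdist a u + hdist u b = hdist a b.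
Proof.
move=> /subsetP abu /subsetP uab; rewrite /hdist -cardsUI.
have -> : symdiff a u :&: symdiff u b = set0.
  apply/setP => x; rewrite in_setI !in_symdiff; move: (abu x) (uab x).
  rewrite !inE.
  by case: (x \in a); case: (x \in b); case: (x \in u) => //= H1 H2;
     try have:= H1 isT; try have:= H2 isT.
rewrite cards0 addn0; apply: eq_card => x; rewrite in_setU !in_symdiff.
move: (abu x) (uab x); rewrite !inE.
by case: (x \in a); case: (x \in b); case: (x \in u) => //= H1 H2;
   try have:= H1 isT; try have:= H2 isT.
Qed.

(** Flipping a coordinate where [u] and [b] differ moves one step towards [b]; iterate [k] times. *)
Lemma hdist_geodesic (d : nat) (k : nat) (u b : {set 'I_d}) :
  k <= hdist u b -> exists w, hdist u w = k /\ k + hdist w b = hdist u b.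
Proof.
elim: k u => [|k IHk] u lek.
  exists u; split=> //; apply/eqP; rewrite cards_eq0; apply/eqP/setP => x.
  by rewrite in_symdiff inE addbb.
have /card_gt0P [i iub] : 0 < #|symdiff u b| by apply: leq_trans lek.
pose v := symdiff u [set i].
have uv : hdist u v = 1.
  rewrite -(cards1 i); apply: eq_card => x.
  by rewrite !in_symdiff addKb.
have vb : (hdist v b).+1 = hdist u b.
  rewrite {2}/hdist (cardsD1 i) iub add1n; congr _.+1; apply: eq_card => x.
  rewrite in_setD1 !in_symdiff in_set1; case: eqP => [->|_].
    by move: iub; rewrite in_symdiff; case: (i \in u); case: (i \in b).
  by rewrite addbF.
have [|w [vw wb]] := IHk v; first by lia.
(* The path through [v] bounds [hdist u w] above by [k.+1]; the path from [u] to [b] through [w]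
   bounds it below. *)
exists w; have := hdist_triangle d u v w; have := hdist_triangle d u w b.
by lia.
Qed.

Lemma midhat_interval (d : nat) (S : {set {set 'I_d}})
    (hS : midhat_set S S \subset S) (a b u : {set 'I_d}) :
  a \in S -> b \in S -> hdist a u + hdist u b = hdist a b -> u \in S.
Proof.
have midS s t v : s \in S -> t \in S -> v \in midhat s t -> v \in S.
  move=> sS tS vst; apply: (subsetP hS); apply/bigcupP; exists s => //.
  by apply/bigcupP; exists t.
have [n] := ubnP (hdist a b); elim: n a b => // n IHn a b ltn aS bS aub.
wlog le_aub : a b ltn aS bS aub / hdist a u <= hdist u b => [gen|].
  have [/gen|lt_bua] := leqP (hdist a u) (hdist u b); first exact.
  by apply: (gen b a) => //; rewrite !(hdistC _ b) 1?(hdistC _ u a); lia.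
(* As [u] is no farther from [a] than from [b], reaching the half-distance means equality with its
   floor: [u] is itself a midpoint. *)
have [lt_au|ge_au] := ltnP (hdist a u) (hdist a b)./2; last first.
  by apply: (midS a b) => //; rewrite !inE aub eqxx; lia.
have [|w [uw wb]] := hdist_geodesic _ ((hdist a b)./2 - hdist a u) u b.
  by lia.
have := hdist_triangle d a u w; have := hdist_triangle d a w b => tri1 tri2.
have aw : hdist a w = (hdist a b)./2 by lia.
have wS : w \in S by apply: (midS a b) => //; rewrite !inE; lia.
(* The distance strictly drops: by [lt_au] the half is positive, hence smaller than [hdist a b]. *)
by apply: (IHn a w) => //; lia.
Qed.

Theorem theorem3p2 (d : nat) (hd : 0 < d) (S : {set {set 'I_d}})
    (hS : midhat_set S S \subset S) :
  exists alpha beta : {set 'I_d},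
    S = [set gamma : {set 'I_d} | (alpha \subset gamma) && (gamma \subset beta)].
Proof.
have intS (a b u : {set 'I_d}) : a \in S -> b \in S ->
    a :&: b \subset u -> u \subset a :|: b -> u \in S.
  move=> aS bS abu uab; apply: (midhat_interval _ _ hS a b) => //.
  exact: hdist_between.
have [->|[s sS]] := set_0Vmem S.
  (* Reversed bounds give an empty interval, since [0 < d] separates [setT] from [set0]. *)
  exists setT, set0; apply/setP => g; rewrite !inE subTset subset0.
  case: eqP => [->|//]; apply/esym/negbTE.
  by rewrite -cards_eq0 cardsT card_ord -lt0n.
(* Extremal cardinality yields extremality for inclusion: [alpha :&: g] is in [S] and inside
   [alpha], so it cannot be smaller and equals [alpha]; dually for [beta]. *)
case: (@arg_minnP _ s (fun g => g \in S) (fun g => #|g|) sS) => alpha aS amin.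
case: (@arg_maxnP _ s (fun g => g \in S) (fun g => #|g|) sS) => beta bS bmax.
have leS g : g \in S -> alpha \subset g.
  move=> gS; have IS : alpha :&: g \in S.
    by apply: (intS alpha g) => //; rewrite subIset // subsetUl.
  apply/setIidPl/eqP; rewrite eqEcard subsetIl; exact: amin.
have geS g : g \in S -> g \subset beta.
  move=> gS; have US : beta :|: g \in S.
    by apply: (intS beta g) => //; rewrite subIset // subsetUl.
  apply/setUidPl/eqP; rewrite eq_sym eqEcard subsetUl; exact: bmax.
exists alpha, beta; apply/setP => g; rewrite inE; apply/idP/andP => [gS|[ag gb]].
  by rewrite leS ?geS.
apply: (intS alpha beta) => //; first by rewrite subIset ?ag.
by rewrite subsetU ?gb ?orbT.
Qed.
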